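(* Let $n \geq 5$ be an odd integer. Then Player $B$ has a winning strategy in the game $Z(n,d)$ for every integer $d$ with $\frac{n+3}{2} \leq d \leq n-1$.
   Context: For integers $n \geq 4$ and $d \geq 2$, $Z(n,d)$ is the following two-player game. Initially the board contains the numbers $1,2,\dots,n$. Players $A$ and $B$ alternately cross out (remove) one number from the board, with $A$ moving first, until exactly two numbers remain. If the sum of the two remaining numbers is divisible by $d$, $A$ wins; otherwise $B$ wins. A player has a winning strategy if that player can force a win regardless of the opponent's moves. *)

(* Defs.v *)
From mathcomp Require Import all_boot.

Set Implicit Arguments.
Unset Strict Implicit.
Unset Printing Implicit Defensive.

(* The game Z(n, d).  A history is the sequence of numbers crossed out so far,
   oldest first. *)

Inductive player := PlayerA | PlayerB.

Definition board (n : nat) (h : seq nat) : seq nat :=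
  [seq k <- iota 1 n | k \notin h].

Definition to_move (h : seq nat) : player :=
  if odd (size h) then PlayerB else PlayerA.

(* Play stops when exactly two numbers are left, so a history has at most
   n - 2 moves. *)
Definition legal_history (n : nat) (h : seq nat) : Prop :=
  [/\ uniq h, {subset h <= iota 1 n} & size h <= n - 2].

Definition finished (n : nat) (h : seq nat) : Prop := size (board n h) = 2.

Definition winner (n d : nat) (h : seq nat) : player :=
  if d %| sumn (board n h) then PlayerA else PlayerB.

(* A strategy sees the whole history; its values matter only at the histories
   where its owner is to move. *)
Definition strategy := seq nat -> nat.

Definition follows (P : player) (s : strategy) (h : seq nat) : Prop :=
  forall i, i < size h -> to_move (take i h) = P -> nth 0 h i = s (take i h).

(* The first clause makes a strategy answer with a number still on the board,
   so that a player cannot win vacuously by getting stuck. *)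
Definition winning_strategy (n d : nat) (P : player) (s : strategy) : Prop :=
  (forall h, legal_history n h -> follows P s h -> ~ finished n h ->
     to_move h = P -> s h \in board n h) /\
  (forall h, legal_history n h -> follows P s h -> finished n h ->
     winner n d h = P).

Definition has_winning_strategy (n d : nat) (P : player) : Prop :=
  exists s : strategy, winning_strategy n d P s.

(* Main.v *)
Require Import Defs.
From mathcomp Require Import all_boot zify.

Set Implicit Arguments.
Unset Strict Implicit.
Unset Printing Implicit Defensive.

(** Join two distinct numbers of the board when their sum is divisible by [d].
    Since [n] is odd, [B] makes [(n - 3) / 2] moves and [A] makes the last one,
    so [B] wins by crossing out a vertex cover of this graph with at most
    [(n - 3) / 2] elements.  Modulo [d], an edge joins the residue classes of
    [r] and [- r]; the cover consists of all the numbers in the smaller class of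
    each such pair, and of [d / 2] when [d / 2] and [3 * d / 2] are both
    on the board. *)

(** The outer default serves once [C] is exhausted, when any remaining number will do. *)
Definition cover_strategy (n : nat) (C : seq nat) : strategy :=
  fun h => head (head 0 (board n h)) [seq k <- C | k \notin h].

Lemma follows_rcons P s h x : follows P s (rcons h x) ->
  follows P s h /\ (to_move h = P -> x = s h).
Proof.
move=> F; split=> [i lt_ih|hP].
- have := F i; rewrite size_rcons nth_rcons lt_ih -cats1 takel_cat 1?ltnW //.
  by move=> Fi; apply: Fi; lia.
- have := F (size h); rewrite size_rcons nth_rcons ltnn eqxx.
  by rewrite -cats1 take_size_cat //; apply.
Qed.

Lemma size_filter_notin_rcons (C h : seq nat) x :
  size [seq k <- C | k \notin rcons h x]
    <= size [seq k <- C | k \notin h] - (x \in [seq k <- C | k \notin h]).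
Proof.
have -> : [seq k <- C | k \notin rcons h x] =
          [seq k <- [seq k <- C | k \notin h] | k != x].
  by rewrite -filter_predI; apply: eq_filter => k /=; rewrite mem_rcons inE negb_or.
set D := [seq k <- C | k \notin h].
rewrite size_filter -(count_predC (pred1 x) D) -has_pred1 has_count.
rewrite -[count (fun _ => _) D]/(count (predC (pred1 x)) D); lia.
Qed.

(** As A moves first, [(size h)./2] counts the moves of B; each removes an element of [C] while one
    is left. *)
Lemma cover_strategy_size n C h : follows PlayerB (cover_strategy n C) h ->
  size [seq k <- C | k \notin h] <= size C - (size h)./2.
Proof.
elim/last_ind: h => [|h x IH] /=.
  by rewrite subn0 size_filter count_size.
move=> /follows_rcons[/IH le_h xE].
apply: leq_trans (size_filter_notin_rcons _ _ _) _.
rewrite size_rcons; move: xE; rewrite /to_move.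
case: ifP => [h_odd /(_ erefl) ->|h_even _]; last by lia.
rewrite /cover_strategy; case: [seq k <- C | k \notin h] le_h => [|y D] /=.
  by lia.
by rewrite inE eqxx; lia.
Qed.

Lemma size_board n h : uniq h -> {subset h <= iota 1 n} ->
  size (board n h) + size h = n.
Proof.
move=> h_uniq h_sub; rewrite -[RHS](size_iota 1) -(count_predC [in h] (iota 1 n)).
rewrite /board size_filter addnC; congr (_ + _).
rewrite -size_filter; apply/perm_size/uniq_perm => //.
  exact/filter_uniq/iota_uniq.
by move=> k; rewrite mem_filter /=; case: (boolP (k \in h)) => [/h_sub|].
Qed.

Lemma cover_winning n d C : odd n -> {subset C <= iota 1 n} ->
    2 * size C + 3 <= n ->
    (forall a b, a \in iota 1 n -> b \in iota 1 n -> a != b -> d %| a + b ->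
       (a \in C) || (b \in C)) ->
  winning_strategy n d PlayerB (cover_strategy n C).
Proof.
move=> n_odd C_sub C_size C_cover; split=> h [h_uniq h_sub h_size] hF.
- move=> hfin _; have := size_board h_uniq h_sub; rewrite /cover_strategy.
  case E: [seq k <- C | k \notin h] => [|y D] /=.
    by case: (board n h) => [|y D] /= ?; [lia | rewrite mem_head].
  move=> _; have : y \in [seq k <- C | k \notin h] by rewrite E mem_head.
  by rewrite /board !mem_filter => /andP[-> /C_sub].
- rewrite /finished => board2; have := size_board h_uniq h_sub.
  rewrite board2 => h_sizeE; have := cover_strategy_size hF.
  (* Here [size h = n - 2] is odd, so B has made [(n - 3) / 2] moves, at least [size C]. *)
  have -> : size C - (size h)./2 = 0.
    by move: h_sizeE n_odd C_size; clear; move: (size h) (size C) => p q; lia.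
  rewrite leqn0 size_eq0 => /eqP D0.
  have notC k : k \in board n h -> k \in iota 1 n /\ k \notin C.
    rewrite mem_filter => /andP[k_h k_n]; split=> //; apply/negP => k_C.
    by have := in_nil k; rewrite -D0 mem_filter k_h k_C.
  have : uniq (board n h) by rewrite filter_uniq ?iota_uniq.
  rewrite /winner; move: (board n h) board2 notC => [|a [|b []]] //= _ notC.
  rewrite inE andbT addn0 => a_neq_b; case: ifP => // d_ab.
  have [a_n a_C] := notC a (mem_head _ _).
  have [|b_n b_C] := notC b; first by rewrite !inE eqxx orbT.
  by have := C_cover _ _ a_n b_n a_neq_b d_ab; rewrite (negPf a_C) (negPf b_C).
Qed.

Theorem theorem3p2p1 (n : nat) (hn : 5 <= n) (hodd : odd n) (d : nat)
    (hd1 : n + 3 <= 2 * d) (hd2 : d <= n - 1) :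
  has_winning_strategy n d PlayerB.
Proof.
(* Only these multiples occur: [2 <= a + b <= 2 * n < 4 * d]. *)
have sumE a b : a \in iota 1 n -> b \in iota 1 n -> d %| a + b ->
    [\/ a + b = d, a + b = 2 * d | a + b = 3 * d].
  rewrite !mem_iota => a_n b_n /dvdnP[[|[|[|[|q]]]] abE].
  - by lia.
  - by constructor 1; lia.
  - by constructor 2; lia.
  - by constructor 3; lia.
  - by nia.
(* If [2 * n < 3 * d] the class of [r] contains two numbers only for
   [r < d / 2], so the numbers strictly between [d / 2] and [d] suffice. *)
have [lt_nd|le_dn] := ltnP (2 * n) (3 * d).
- exists (cover_strategy n (iota d./2.+1 (d.-1)./2)).
  apply: cover_winning => // [k||a b a_n b_n a_neq_b /(sumE _ _ a_n b_n)].
  + by rewrite !mem_iota; lia.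
  + by rewrite size_iota; lia.
  + by move: a_n b_n; rewrite !mem_iota => a_n b_n [] abE; lia.
(* The first block runs from [d / 2], rounded up, to [d - 1] and meets each pair of sum [d]. A pair
   of sum [2 * d] that avoids it, like any pair of sum [3 * d], has its larger term above
   [3 * d / 2], in the second block. The size is [n - d], so [n + 3 <= 2 * d] is exactly the size
   bound. *)
- exists (cover_strategy n
    (iota (uphalf d) d./2 ++ iota (3 * d)./2.+1 (n - (3 * d)./2))).
  apply: cover_winning => // [k||a b a_n b_n a_neq_b /(sumE _ _ a_n b_n)].
  + by rewrite mem_cat !mem_iota; lia.
  + by rewrite size_cat !size_iota; lia.
  + by move: a_n b_n; rewrite !mem_cat !mem_iota => a_n b_n [] abE; lia.
Qed.
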